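(* Let $k\ge1$, $n\ge1$, $m=kn+1$, $N=m+n-1=(k+1)n$, let $D\in\mathcal D_{m,n}$ and $T=T(D)$. Let $b_j=T_{k+1,j}$ be the bottom row entries and $B=\{b_1+1,\dots,b_n+1\}$ (the ''bold'' entries; note $N+1\in B$). Define $f:\{1,\dots,N+1\}\to\{1,\dots,N+1\}$ by: if $x=T_{1,j}$ is in the first row, $f(x)=b_j+1$; if $x=T_{i,j}$ with $i\ge 2$, let $y=T_{i-1,j}$ and set $f(x)=y$ if $y\notin B$, and $f(x)=\max\{z<y: z\notin B\}$ if $y\in B$; finally $f(N+1)=\max\{z\le N: z\notin B\}$. Set $\sigma_1=1$ and $\sigma_{i+1}=f(\sigma_i)$. Then $(\sigma_1,\dots,\sigma_{m+n})$ is a permutation of $\{1,\dots,m+n\}$ with $f(\sigma_{m+n})=1$, and the word $\omega_1\cdots\omega_{m+n}$ with $\omega_i=S$ if $\sigma_i$ lies in the first row of $T$ and $\omega_i=W$ otherwise is the step word of a path $\overline D\in\mathcal D_{m,n}$ with $\Phi(\overline D)=D$; that is, $\omega=\mathrm{SW}(\Phi^{-1}(D))$, so the $i$-th letter of $\mathrm{SW}(\Phi^{-1}(D))$ is the $\sigma_i$-th letter of $\mathrm{SW}(D)$.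
   Context: Let $m,n$ be coprime positive integers. $\mathcal D_{m,n}$ is the set of lattice paths from $(0,0)$ to $(m,n)$ with unit North and East steps staying weakly above the segment from $(0,0)$ to $(m,n)$. The rank of a lattice point $(x,y)$ is $ym-xn$; the starting vertices of the $m+n$ steps of a path have distinct ranks. $\mathrm{SW}(P)$ is the word whose $i$-th letter is $S$ if the $i$-th step of $P$ is North and $W$ if East. The sweep map $\Phi:\mathcal D_{m,n}\to\mathcal D_{m,n}$ sends $P$ to the path whose $i$-th step is North iff the step of $P$ with the $i$-th smallest starting rank is North. Filling algorithm (for $m=kn+1$): $T(D)$ is the array with $k+1$ rows and $n$ columns obtained by reading the first $m+n-1$ letters of $\mathrm{SW}(D)$: place $1$ at the top of column 1; for $i=2,\dots,m+n-1$, if the $i$-th letter is $S$ place $i$ at the top of the leftmost empty column, and if $W$ place $i$ immediately below the smallest active entry (an entry is active if it is currently lowest in its column and not in row $k+1$). $T_{i,j}$ denotes the entry in row $i$ (from the top) and column $j$ (from the left). *)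

(* Defs.v *)
From HB Require Import structures.
From mathcomp Require Import all_boot all_order all_algebra.

Set Implicit Arguments.
Unset Strict Implicit.
Unset Printing Implicit Defensive.

(* A lattice path is encoded by its step word, [true] being a North step and
   [false] an East step.  With [true] read as the letter S and [false] as the
   letter W, the same word is SW(P). *)
Definition path_word := seq bool.

(* Coordinates of the lattice point reached after the first i steps; for
   0-based i this is the starting vertex of the step [nth _ P i]. *)
Definition xcoord (P : path_word) (i : nat) : nat := count negb (take i P).
Definition ycoord (P : path_word) (i : nat) : nat := count id (take i P).

Definition rank (m n x y : nat) : int := ((y * m)%:Z - (x * n)%:Z)%R.

Definition vertex_rank (m n : nat) (P : path_word) (i : nat) : int :=
  rank m n (xcoord P i) (ycoord P i).

(* A lattice point lies weakly above the line through (0,0) and (m,n) iff its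
   rank is nonnegative. *)
Definition dyck (m n : nat) : pred path_word := fun P =>
  [&& size P == m + n, xcoord P (m + n) == m, ycoord P (m + n) == n
    & all (fun i => (0 <= vertex_rank m n P i)%R) (iota 0 (m + n).+1)].

Definition sweep (m n : nat) (P : path_word) : path_word :=
  [seq nth false P i |
    i <- sort (fun i j => (vertex_rank m n P i <= vertex_rank m n P j)%R)
              (iota 0 (size P))].

(* A (partially filled) array is the sequence of its columns from left to
   right, each column listing its entries from top to bottom. *)
Definition array := seq (seq nat).

Definition active (k : nat) (c : seq nat) : bool :=
  (c != [::]) && (size c != k.+1).

Definition smallest_active (k : nat) (T : array) : nat :=
  head 0 (sort leq [seq last 0 c | c <- T & active k c]).

Definition place (k : nat) (T : array) (il : nat * bool) : array :=
  let: (i, l) := il in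
  let j := if l then index [::] T
           else find (fun c => active k c && (last 0 c == smallest_active k T)) T
  in set_nth [::] T j (rcons (nth [::] T j) i).

(* Here m = kn+1, so that m+n-1 = (k+1)n. *)
Definition filling (k n : nat) (D : path_word) : array :=
  let N := k.+1 * n in
  foldl (place k) ([:: 1] :: nseq n.-1 [::])
        (zip (iota 2 N.-1) (behead (take N D))).

Definition first_row (T : array) : seq nat := [seq nth 0 c 0 | c <- T].

Definition bottom_row (k : nat) (T : array) : seq nat := [seq nth 0 c k | c <- T].

Definition bold (k : nat) (T : array) : seq nat :=
  [seq b.+1 | b <- bottom_row k T].

(* max {1 <= z < y : z not in B}; equal to 0 only if this set is empty. *)
Definition max_nonbold_below (B : seq nat) (y : nat) : nat :=
  \max_(1 <= z < y | z \notin B) z.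

(* The entry x is [nth 0 c i], i.e. it sits in (1-based) row i.+1. *)
Definition succ_fun (k N : nat) (T : array) (x : nat) : nat :=
  let B := bold k T in
  if x == N.+1 then max_nonbold_below B N.+1
  else
    let c := nth [::] T (find (fun c => x \in c) T) in
    match index x c with
    | 0 => (nth 0 c k).+1
    | i.+1 => let y := nth 0 c i in
              if y \in B then max_nonbold_below B y else y
    end.

(* Main.v *)
(* A North step raises the rank by kn + 1 and an East step lowers it by n.  Let
   a_1 < ... < a_n be the ranks of the starting vertices of the North steps of
   a path P; they are distinct modulo n.  Telescoping the number of terms at
   most t in v, v + n, v + 2n, ... along the closed path shows that, for every
   t = a_j + ln with 0 <= l <= k, the number of vertices of rank at most t
   equals the number of values a_i + l'n (0 <= l' <= k) that are at most t.
   Hence T_{l+1,j} := #{vertices of rank <= a_j + ln} is a bijective filling by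
   1, ..., (k+1)n, and it is the one that the filling algorithm builds from
   Phi(P).  In particular b_j + 1 is the position of the vertex of rank
   a_j + kn + 1, which follows the j-th North step, and since subtracting n is
   increasing, f maps the position of each vertex to that of the next vertex.
   So P is recovered from Phi(P): the sweep map is injective, and as it
   preserves the finite set of Dyck paths it is bijective. *)
Require Import Defs.
From HB Require Import structures.
From mathcomp Require Import all_boot all_order all_algebra.
From mathcomp Require Import zify.

Set Implicit Arguments.
Unset Strict Implicit.
Unset Printing Implicit Defensive.

(** * Characterisations of [find], of the head of a sorted sequence and of [max_nonbold_below] *)

Lemma find_eq (T : Type) (x0 : T) (a : pred T) (s : seq T) (i : nat) :
  i < size s -> a (nth x0 s i) -> (forall j, j < i -> ~~ a (nth x0 s j)) ->
  find a s = i.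
Proof.
move=> lt_is ai before_i; apply/eqP; rewrite eqn_leq; apply/andP; split.
  by rewrite leqNgt; apply/negP => /(before_find x0); rewrite ai.
rewrite leqNgt; apply/negP => lt_fi; move: (before_i _ lt_fi).
by rewrite nth_find // has_find (ltn_trans lt_fi).
Qed.

Lemma head_sort_leq (s : seq nat) (x : nat) :
  x \in s -> all (leq x) s -> head 0 (sort leq s) = x.
Proof.
move=> xs /allP x_min; have := sort_sorted leq_total s.
have: x \in sort leq s by rewrite mem_sort.
have: {in sort leq s, forall y, x <= y} by move=> y; rewrite mem_sort; apply: x_min.
case: (sort leq s) => [|y t] //= x_min_t xt y_min; apply/eqP.
rewrite eqn_leq (x_min_t y (mem_head _ _)) andbT.
move: xt; rewrite inE => /predU1P[->|xt] //.
by have /allP := order_path_min leq_trans y_min; apply.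
Qed.

Lemma max_nonbold_below_eq (B : seq nat) (y z : nat) :
  0 < z < y -> z \notin B ->
  (forall x, 0 < x < y -> x \notin B -> x <= z) -> max_nonbold_below B y = z.
Proof.
move=> z_int zB z_max; apply/eqP; rewrite eqn_leq /max_nonbold_below; apply/andP; split.
  by apply/bigmax_leqP_seq => x; rewrite mem_index_iota => /z_max.
by apply: leq_bigmax_seq; rewrite ?mem_index_iota.
Qed.

(** * The filling algorithm rebuilds any array [E] satisfying suitable order conditions *)

Section Filling.

Variables (k n : nat) (D : path_word) (E : nat -> nat -> nat).
Let N := k.+1 * n.

Hypothesis n_gt0 : 0 < n.
Hypothesis size_D : N <= size D.
Hypothesis E_range : forall j l, j < n -> l <= k -> 0 < E j l <= N.
Hypothesis E_onto : forall p, 0 < p <= N -> exists j l, [/\ j < n, l <= k & E j l = p].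
Hypothesis E_inj : forall j l j' l', j < n -> l <= k -> j' < n -> l' <= k ->
  E j l = E j' l' -> j = j' /\ l = l'.
Hypothesis E_col : forall j l, j < n -> l < k -> E j l < E j l.+1.
Hypothesis E_row : forall j j', j < j' -> j' < n -> E j 0 < E j' 0.
Hypothesis E_shift : forall j l j' l', j < n -> l < k -> j' < n -> l' < k ->
  E j l.+1 <= E j' l'.+1 -> E j l <= E j' l'.
Hypothesis E_letter : forall j l, j < n -> l <= k -> nth false D (E j l).-1 = (l == 0).

(** The part of column [j] present once 1, ..., p have been placed; since columns increase downwards
    it is a top segment of the column. *)
Let column (j p : nat) : seq nat := [seq x <- mkseq (E j) k.+1 | x <= p].
Let state (p : nat) : array := mkseq (column^~ p) n.

Lemma entry_leq_col (j l l' : nat) : j < n -> l <= l' -> l' <= k -> E j l <= E j l'.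
Proof.
move=> jn; elim: l' => [|l' IHl]; first by rewrite leqn0 => /eqP->.
rewrite leq_eqVlt => /predU1P[-> //|lt_ll' lt_l'k].
by apply: leq_trans (ltnW (E_col jn lt_l'k)); apply: IHl => //; apply: ltnW.
Qed.

Lemma columnE (j l p : nat) : j < n -> l <= k.+1 -> (0 < l -> E j l.-1 <= p) ->
  (l <= k -> p < E j l) -> column j p = mkseq (E j) l.
Proof.
move=> jn lk le_p lt_p; rewrite /column /mkseq -(subnKC lk) iotaD map_cat filter_cat.
rewrite (_ : filter _ (map _ (iota 0 l)) = map (E j) (iota 0 l)); last first.
  apply/all_filterP/allP => _ /mapP[i + ->]; rewrite mem_iota add0n => /andP[_ lt_il].
  by apply: leq_trans (le_p _); [apply: entry_leq_col; lia | lia].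
rewrite (_ : filter _ _ = [::]) ?cats0 //; apply/eqP; rewrite -[_ == _]negbK -has_filter.
apply/hasPn => _ /mapP[i + ->]; rewrite mem_iota -ltnNge => le_li.
by apply: (leq_trans (lt_p _)); [lia | apply: entry_leq_col; lia].
Qed.

(** Supplies the height needed by [columnE]: the first row whose entry exceeds [p], or [k.+1] if
    there is none. *)
Lemma column_height (j p : nat) :
  exists2 l, l <= k.+1 & (0 < l -> E j l.-1 <= p) /\ (l <= k -> p < E j l).
Proof.
pose a l := p < E j l; exists (find a (iota 0 k.+1)).
  by rewrite -[X in _ <= X](size_iota 0) find_size.
split=> [l_gt0|lk].
  have lt_f : (find a (iota 0 k.+1)).-1 < find a (iota 0 k.+1) by lia.
  have /negbT := before_find 0 lt_f; rewrite nth_iota; last first.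
    by have := find_size a (iota 0 k.+1); rewrite size_iota; lia.
  by rewrite add0n /a -leqNgt.
have : has a (iota 0 k.+1) by rewrite has_find size_iota.
by move/(nth_find 0); rewrite nth_iota.
Qed.

Lemma column_full (j p : nat) : j < n -> N <= p -> column j p = mkseq (E j) k.+1.
Proof.
move=> jn Np; apply: columnE => //; last by rewrite ltnn.
by move=> _; have /andP[_ /leq_trans] := E_range jn (leqnn k); apply.
Qed.

(** Let p + 1 be the entry [E j0 l0]. If it is in the first row, [E_row] makes [j0] the leftmost
    empty column. Otherwise every active column is waiting for an entry that is at least p + 1, and
    [E_shift] carries this comparison one row up: the entry above p + 1 is the smallest active
    one. *)
Lemma place_state (p : nat) : 0 < p < N ->
  place k (state p) (p.+1, nth false D p) = state p.+1.
Proof.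
move=> /andP[p_gt0 ltpN].
have [j0 [l0 [j0n l0k Ep]]] : exists j l, [/\ j < n, l <= k & E j l = p.+1].
  by apply: E_onto; rewrite ltpN.
have letter : nth false D p = (l0 == 0) by rewrite -(E_letter j0n l0k) Ep.
have col0 : column j0 p = mkseq (E j0) l0.
  apply: columnE => //; [exact: leqW | | by rewrite Ep].
  by case: l0 l0k Ep {letter} => // l0 l0k Ep _; have := E_col j0n l0k; rewrite Ep.
have col1 : column j0 p.+1 = rcons (mkseq (E j0) l0) p.+1.
  rewrite -Ep -mkseqS; apply: columnE => // lt_l0k; exact: E_col.
have nth_state i : i < n -> nth [::] (state p) i = column i p by move=> ?; rewrite nth_mkseq.
have target : (if nth false D p then index [::] (state p)
    else find (fun c => active k c && (last 0 c == smallest_active k (state p))) (state p)) = j0.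
  rewrite letter; case: l0 l0k Ep col0 {letter col1} => [|l0] l0k Ep col0 /=.
    apply: (find_eq (x0 := [::])) => [||j lt_j]; rewrite ?size_mkseq //.
      by rewrite nth_state ?col0.
    rewrite nth_state /=; last exact: ltn_trans lt_j j0n.
    rewrite (_ : _ == _ = ~~ has predT (column j p)) ?negbK; last by case: (column j p).
    apply/hasP; exists (E j 0) => //; rewrite mem_filter -ltnS -Ep E_row //=.
    by apply/mapP; exists 0; rewrite ?mem_iota.
  have last0 : last 0 (column j0 p) = E j0 l0 by rewrite col0 mkseqS last_rcons.
  have act0 : active k (column j0 p).
    by rewrite /active col0 -size_eq0 size_mkseq /= eqSS neq_ltn l0k.
  (* The lowest entry of an active column is followed, one row down, by an entry not yet placed. *)
  have last_active j : j < n -> active k (column j p) ->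
      exists l, [/\ l < k, last 0 (column j p) = E j l & p < E j l.+1].
    move=> jn; have [l lk [le_p lt_p]] := column_height j p.
    rewrite (columnE jn lk le_p lt_p) /active -size_eq0 size_mkseq.
    case: l lk le_p lt_p => // l lk le_p lt_p /andP[_ ne_lk]; have lt_lk : l < k by lia.
    by exists l; rewrite mkseqS last_rcons lt_lk lt_p.
  have smallest : smallest_active k (state p) = E j0 l0.
    apply: head_sort_leq.
      rewrite -last0; apply: map_f; rewrite mem_filter act0.
      by rewrite -(nth_state j0 j0n) mem_nth // size_mkseq.
    apply/allP => _ /mapP[c + ->]; rewrite mem_filter => /andP[act_c /mapP[j]].
    rewrite mem_iota add0n => /andP[_ jn] c_eq; subst c.
    have [l [lk -> lt_p]] := last_active j jn act_c.
    by apply: E_shift => //; rewrite Ep.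
  apply: (find_eq (x0 := [::])) => [||j lt_j]; rewrite ?size_mkseq //.
    by rewrite nth_state // act0 last0 smallest eqxx.
  have jn := ltn_trans lt_j j0n; rewrite nth_state // smallest.
  apply/negP => /andP[/(last_active _ jn)[l [lk -> _]] /eqP E_eq].
  have [] := E_inj jn (ltnW lk) j0n (ltnW l0k) E_eq; lia.
rewrite /place target nth_state //; apply: (@eq_from_nth _ [::]) => [|i].
  by rewrite size_set_nth !size_mkseq; apply/maxn_idPr.
rewrite size_set_nth size_mkseq (maxn_idPr j0n) => lt_in.
rewrite nth_set_nth /= nth_state // nth_mkseq //.
case: eqP => [->|ne_ij]; first by rewrite col0 col1.
apply: eq_in_filter => x /mapP[l]; rewrite mem_iota add0n => /andP[_ lk] ->.
have ne : E i l <> p.+1 by rewrite -Ep => /(E_inj lt_in lk j0n l0k)[].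
by apply/idP/idP; lia.
Qed.

Lemma first_state : [:: 1] :: nseq n.-1 [::] = state 1.
Proof.
have [j [l [jn lk El]]] : exists j l, [/\ j < n, l <= k & E j l = 1].
  by apply: E_onto; rewrite muln_gt0 n_gt0.
have := entry_leq_col jn (leq0n l) lk; rewrite El => le1.
(* The entry 1 is minimal, while columns and the first row increase, so it can only sit in the
   corner. *)
have E00 : E 0 0 = 1.
  have := E_range n_gt0 (leq0n k); case: j jn El le1 => [|j] jn _ le1; first by lia.
  by have := E_row (ltn0Sn j) jn; lia.
apply: (@eq_from_nth _ [::]) => [|i]; first by rewrite /= size_nseq size_mkseq prednK.
rewrite /= size_nseq prednK // => lt_in; rewrite nth_mkseq //; case: i lt_in => [|i] lt_in.
  have -> : column 0 1 = mkseq (E 0) 1; last by rewrite /mkseq /= E00.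
  by apply: columnE => // [|lt_k]; rewrite /= -{1}E00 //; apply: E_col.
have -> : column i.+1 1 = mkseq (E i.+1) 0; last by rewrite /= nth_nseq if_same.
by apply: columnE => // _; rewrite -{1}E00; apply: E_row.
Qed.

Lemma filling_entries : filling k n D = mkseq (fun j => mkseq (E j) k.+1) n.
Proof.
rewrite /filling first_state -/N.
have Npos : 0 < N by rewrite muln_gt0.
have -> : zip (iota 2 N.-1) (behead (take N D)) =
    [seq (i, nth false D i.-1) | i <- iota 2 N.-1].
  apply: (@eq_from_nth _ (0, false)) => [|i].
    by rewrite size_zip size_behead size_takel // size_map !size_iota minnn.
  rewrite size_zip size_behead size_takel // !size_iota minnn => lt_iN.
  rewrite nth_zip; last by rewrite size_behead size_takel ?size_iota.
  rewrite (nth_map 0) ?size_iota // nth_iota // nth_behead nth_take //; lia.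
suff fold_state q p : 0 < p -> p + q = N ->
    foldl (place k) (state p) [seq (i, nth false D i.-1) | i <- iota p.+1 q] = state N.
  rewrite (fold_state _ 1) //; last by lia.
  by apply/eq_in_map => j; rewrite mem_iota => /andP[_ jn]; apply: column_full.
elim: q p => [|q IHq] p p_gt0 sum_pq; first by rewrite -sum_pq addn0.
rewrite -(IHq p.+1) //; last by lia.
by rewrite -place_state //; lia.
Qed.

End Filling.

(** * Comparison of sums, and sums along a closed cycle *)

Lemma ltn_sum (I : finType) (Q : pred I) (F G : I -> nat) (i0 : I) :
  Q i0 -> (forall i, Q i -> F i <= G i) -> F i0 < G i0 ->
  \sum_(i | Q i) F i < \sum_(i | Q i) G i.
Proof.
move=> Qi0 leFG ltFG; rewrite (bigD1 i0) //= [X in _ < X](bigD1 i0) //= -addSn.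
by apply: leq_add => //; apply: leq_sum => i /andP[/leFG].
Qed.

Lemma sum_cycle (M : nat) (r F : nat -> nat) :
  r M = r 0 -> \sum_(i < M) F (r i.+1) = \sum_(i < M) F (r i).
Proof.
move=> r_M; apply/eqP; rewrite -(eqn_add2l (F (r 0))) -(big_ord_recl M (fun i => F (r i))).
by rewrite big_ord_recr /= r_M addnC.
Qed.

(** * Positions of vertices in the order by rank, for an abstract closed cycle of ranks *)

Section RankCycle.

Variables (k n : nat) (P : path_word) (r : nat -> nat).
Let M := (k.+1 * n).+1.

Hypothesis n_gt0 : 0 < n.
Hypothesis r_0 : r 0 = 0.
Hypothesis r_M : r M = 0.
Hypothesis r_north : forall i, i < M -> nth false P i -> r i.+1 = (r i + k * n).+1.
Hypothesis r_east : forall i, i < M -> ~~ nth false P i -> r i = r i.+1 + n.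
Hypothesis r_inj : forall i j, i < M -> j < M -> r i = r j -> i = j.
Hypothesis north_inj_mod : forall i j, i < M -> j < M ->
  nth false P i -> nth false P j -> r i = r j %[mod n] -> i = j.
Hypothesis count_north : count (nth false P) (iota 0 M) = n.

(** At [t = r i] this is the 1-based position of vertex [i] in the order by rank, hence the index of
    step [i] in the swept word. *)
Definition nranks (t : nat) : nat := \sum_(i < M) (r i <= t).

Lemma nranks_shift (t : nat) : nranks t = \sum_(i < M) (r i.+1 <= t).
Proof. by rewrite (sum_cycle (fun v => v <= t : nat)) // r_M. Qed.

Lemma nranks_leq (t t' : nat) : t <= t' -> nranks t <= nranks t'.
Proof. by move=> le_tt'; apply: leq_sum => i _; case: (leqP (r i) t) => // /leq_trans->. Qed.

Lemma nranks_max (t : nat) : nranks t <= M.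
Proof.
apply: (@leq_trans (\sum_(i < M) 1)); last by rewrite sum1_card card_ord.
by apply: leq_sum => i _; apply: leq_b1.
Qed.

(** Lets facts about starting vertices also be applied to the end [i.+1] of a step, which may be the
    closing vertex [M]. *)
Lemma rank_wrap (i : nat) : i <= M -> exists2 i', i' < M & r i' = r i.
Proof.
rewrite leq_eqVlt => /predU1P[->|]; last by exists i.
by exists 0; rewrite ?r_M.
Qed.

Lemma nranks_rank_ltn (i t : nat) : i <= M -> t < r i -> nranks t < nranks (r i).
Proof.
move=> /rank_wrap[{}i lt_iM <-] lt_ti; apply: (ltn_sum (i0 := Ordinal lt_iM)) => //=.
  by move=> j _; case: (leqP (r j) t) => // le_jt; rewrite (leq_trans le_jt (ltnW lt_ti)).
by rewrite leqnn (leqNgt (r i)) lt_ti.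
Qed.

Lemma nranks_rank_leq (i t : nat) : i <= M -> (nranks (r i) <= nranks t) = (r i <= t).
Proof.
move=> le_iM; apply/idP/idP; last exact: nranks_leq.
by apply: contraLR; rewrite -!ltnNge; apply: nranks_rank_ltn.
Qed.

Lemma nranks_gt0 (t : nat) : 0 < nranks t.
Proof.
have : nranks (r 0) <= nranks t by rewrite nranks_rank_leq // r_0.
by apply: leq_trans; rewrite /nranks big_ord_recl leqnn.
Qed.

Lemma nranks_rank_inj (i j : nat) : i < M -> j < M ->
  nranks (r i) = nranks (r j) -> i = j.
Proof.
move=> iM jM eq_ij; apply: r_inj => //; apply/eqP.
by rewrite eqn_leq -(nranks_rank_leq (r j) (ltnW iM)) -(nranks_rank_leq (r i) (ltnW jM)) eq_ij leqnn.
Qed.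

(** Ranks are distinct, so exactly one vertex is gained when the threshold reaches the rank of a
    vertex. *)
Lemma nranks_rankS (i t : nat) : i <= M -> r i = t.+1 -> nranks t.+1 = (nranks t).+1.
Proof.
move=> /rank_wrap[{}i lt_iM <-] r_i.
rewrite /nranks (bigD1 (Ordinal lt_iM)) //= [X in _ = X.+1](bigD1 (Ordinal lt_iM)) //=.
rewrite r_i leqnn ltnn; congr (_.+1); apply: eq_bigr => j ne_j.
rewrite leq_eqVlt ltnS; case: eqP => //= r_j; case/eqP: ne_j; apply: val_inj => /=.
by apply: r_inj; rewrite ?r_j ?r_i.
Qed.

Lemma nranks_perm : perm_eq [seq nranks (r i) | i <- iota 0 M] (iota 1 M).
Proof.
have uniq_pos : uniq [seq nranks (r i) | i <- iota 0 M].
  rewrite map_inj_in_uniq ?iota_uniq // => i j; rewrite !mem_iota.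
  exact: nranks_rank_inj.
apply: uniq_perm; rewrite ?iota_uniq //.
apply: (uniq_min_size uniq_pos _ _).2; last by rewrite size_map !size_iota.
by move=> _ /mapP[i _ ->]; rewrite mem_iota nranks_gt0 add1n ltnS nranks_max.
Qed.

Lemma nranks_onto (p : nat) : 0 < p <= M -> exists2 i, i < M & nranks (r i) = p.
Proof.
move=> p_range; have : p \in iota 1 M by rewrite mem_iota add1n ltnS.
by rewrite -(perm_mem nranks_perm) => /mapP[i]; rewrite mem_iota => iM ->; exists i.
Qed.

(** * Counting vertices and array entries below a threshold *)

Definition nentries (t : nat) : nat :=
  \sum_(i < M | nth false P i) \sum_(l < k.+1) (r i + l * n <= t).

Definition entry_value (t : nat) : Prop :=
  exists i l, [/\ i < M, nth false P i, l <= k & t = r i + l * n].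

(* [nterms v t] counts the terms at most [t] in v, v + n, v + 2n, ...; it
   telescopes along the cyclic path. *)
Definition nterms (v t : nat) : nat := (t + n - v) %/ n.

Lemma ntermsD (v t : nat) : nterms v t = (v <= t) + nterms (v + n) t.
Proof.
rewrite /nterms; case: leqP => [le_vt | lt_tv] /=.
  by rewrite (_ : t + n - v = 1 * n + (t - v)) ?divnMDl // 1?subnDr //; lia.
by rewrite !divn_small //; lia.
Qed.

Lemma nterms_iter (q v t : nat) :
  nterms v t = \sum_(l < q) (v + l * n <= t) + nterms (v + q * n) t.
Proof.
elim: q => [|q IHq]; first by rewrite big_ord0 addn0.
by rewrite big_ord_recr /= -addnA IHq (ntermsD (v + q * n)) -addnA -mulSnr.
Qed.

(** Shifting the whole progression up by one pushes a term past [t] only if some term equals [t]. *)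
Lemma nterms_succ (v t : nat) : ~~ ((v <= t) && (n %| t - v)) ->
  nterms v.+1 t = nterms v t.
Proof.
rewrite /nterms; case: (leqP v t) => [le_vt | lt_tv] /= ndvd.
  rewrite (_ : t + n - v = (t + n - v.+1).+1); last by lia.
  rewrite divnS // (_ : (t + n - v.+1).+1 = t - v + n); last by lia.
  by rewrite dvdn_addl // (negbTE ndvd).
by rewrite !divn_small //; lia.
Qed.

Lemma entry_count (t : nat) : entry_value t -> nranks t = nentries t.
Proof.
move=> [i0 [l0 [lt_i0M north_i0 le_l0k t_eq]]].
(* The balance of a single step. An East step prepends one term to the progression; a North step
   removes the first k + 1 terms, up to a shift by one. *)
have step (i : 'I_M) : nterms (r i.+1) t +
    (if nth false P i then \sum_(l < k.+1) (r i + l * n <= t) else 0) =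
    (r i.+1 <= t) + nterms (r i) t.
  case: ifP => [north_i | /negbT east_i]; last first.
    by rewrite addn0 ntermsD -(r_east _ east_i).
  rewrite [nterms (r i) t](nterms_iter k.+1) ntermsD (r_north _ north_i) // addSn.
  rewrite (_ : r i + k * n + n = r i + k.+1 * n); last by rewrite mulSnr addnA.
  (* The shift is harmless unless [t] is a term from r i + (k + 1)n on. Then [t] and [r i] are
     congruent modulo n, so [i = i0] and t = r i + l0 n with l0 at most k, which is too small. *)
  rewrite nterms_succ; first by rewrite -addnA (addnC (nterms _ _)).
  apply/negP => /andP[le_t /dvdnP[q q_eq]].
  have i_i0 : (i : nat) = i0.
    apply: north_inj_mod => //.
    rewrite -(modnMDl (k.+1 + q) (r i)) -(modnMDl l0 (r i0)); congr (_ %% _).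
    by rewrite mulnDl -q_eq addnAC (addnC _ (r i)) subnKC // t_eq addnC.
  by move: le_t; rewrite t_eq i_i0 leq_add2l leq_pmul2r // ltnNge le_l0k.
have : \sum_(i < M) nterms (r i.+1) t + nentries t = nranks t + \sum_(i < M) nterms (r i) t.
  rewrite /nentries [X in _ + X = _]big_mkcond nranks_shift -!big_split /=.
  by apply: eq_bigr => i _; apply: step.
by rewrite (sum_cycle (nterms^~ t)) ?r_M //; lia.
Qed.

Lemma nentries_ltn (t t' : nat) : entry_value t' -> t < t' -> nentries t < nentries t'.
Proof.
move=> [i0 [l0 [lt_i0M north_i0 le_l0k ->]]] lt_t.
have le_term (i l : nat) : (r i + l * n <= t) <= (r i + l * n <= r i0 + l0 * n).
  by case: (leqP (r i + l * n) t) => // le_t; rewrite (leq_trans le_t (ltnW lt_t)).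
apply: (ltn_sum (i0 := Ordinal lt_i0M)) => //= [i _ |]; first by apply: leq_sum => l _.
have lt_l0 : l0 < k.+1 by [].
by apply: (ltn_sum (i0 := Ordinal lt_l0)) => //=; rewrite leqnn (leqNgt (r i0 + _)) lt_t.
Qed.

(** In general [nranks] is only weakly increasing; on entry values it agrees with [nentries], which
    grows strictly because each such threshold counts itself. *)
Lemma nranks_entry_ltn (t t' : nat) : entry_value t -> entry_value t' ->
  (nranks t < nranks t') = (t < t').
Proof.
move=> et et'; apply/idP/idP => [|lt_t]; last by rewrite !entry_count // nentries_ltn.
by rewrite !ltnNge; apply: contra; apply: nranks_leq.
Qed.

Lemma nranks_entry_leq (t t' : nat) : entry_value t -> entry_value t' ->
  (nranks t <= nranks t') = (t <= t').
Proof. by move=> et et'; rewrite leqNgt nranks_entry_ltn // -leqNgt. Qed.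

Lemma nranks_entry_inj (t t' : nat) : entry_value t -> entry_value t' ->
  nranks t = nranks t' -> t = t'.
Proof.
move=> et et' eq_t; apply/eqP.
by rewrite eqn_leq -(nranks_entry_leq et et') -(nranks_entry_leq et' et) eq_t leqnn.
Qed.

(** * The array read off from the ranks of the North steps *)

Definition north_ranks : seq nat :=
  sort leq [seq r i | i <- iota 0 M & nth false P i].

Definition north_rank (j : nat) : nat := nth 0 north_ranks j.

(** The intended array, with 0-based indices: row l + 1, column j + 1. *)
Definition entry (j l : nat) : nat := nranks (north_rank j + l * n).

Lemma size_north_ranks : size north_ranks = n.
Proof. by rewrite size_sort size_map size_filter. Qed.

Lemma mem_north_ranks (x : nat) :
  reflect (exists i, [/\ i < M, nth false P i & x = r i]) (x \in north_ranks).
Proof.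
rewrite mem_sort; apply: (iffP mapP) => [[i + ->]|[i [iM north_i ->]]].
  by rewrite mem_filter mem_iota => /andP[north_i iM]; exists i.
by exists i; rewrite // mem_filter mem_iota north_i.
Qed.

Lemma north_rankP (j : nat) : j < n ->
  exists i, [/\ i < M, nth false P i & north_rank j = r i].
Proof. by move=> jn; apply/mem_north_ranks/mem_nth; rewrite size_north_ranks. Qed.

Lemma north_rank_onto (i : nat) : i < M -> nth false P i ->
  exists2 j, j < n & north_rank j = r i.
Proof.
move=> iM north_i; have : r i \in north_ranks by apply/mem_north_ranks; exists i.
by case/(nthP 0) => j; rewrite size_north_ranks => jn <-; exists j.
Qed.

Lemma north_rank_ltn (j j' : nat) : j < j' -> j' < n -> north_rank j < north_rank j'.
Proof.
move=> lt_jj' jn'; apply: (sorted_ltn_nth ltn_trans) => //; last 2 first.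
- by rewrite inE size_north_ranks (ltn_trans lt_jj').
- by rewrite inE size_north_ranks.
rewrite ltn_sorted_uniq_leq sort_sorted ?andbT; last exact: leq_total.
rewrite sort_uniq map_inj_in_uniq ?filter_uniq ?iota_uniq // => i j0.
by rewrite !mem_filter !mem_iota => /andP[_ iM] /andP[_ jM]; apply: r_inj.
Qed.

Lemma entry_valueP (j l : nat) : j < n -> l <= k -> entry_value (north_rank j + l * n).
Proof.
by move=> /north_rankP[i [iM north_i ->]] lk; exists i, l.
Qed.

(** Equal entries come from equal thresholds; the residue modulo n determines the North step, hence
    the column, and then the row. *)
Lemma entry_inj (j l j' l' : nat) : j < n -> l <= k -> j' < n -> l' <= k ->
  entry j l = entry j' l' -> j = j' /\ l = l'.
Proof.
move=> jn lk jn' lk' /nranks_entry_inj-/(_ (entry_valueP jn lk) (entry_valueP jn' lk')) eq_t.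
have [i [iM north_i r_i]] := north_rankP jn.
have [i' [iM' north_i' r_i']] := north_rankP jn'.
have eq_i : i = i'.
  apply: north_inj_mod => //; rewrite -r_i -r_i'.
  by rewrite -(modnMDl l) -[RHS](modnMDl l') addnC eq_t addnC.
have eq_rank : north_rank j = north_rank j' by rewrite r_i r_i' eq_i.
split; last by apply/eqP; rewrite -(eqn_pmul2r n_gt0); apply/eqP; lia.
case: (ltngtP j j') => // [lt_jj' | lt_jj'].
  by have := north_rank_ltn lt_jj' jn'; lia.
by have := north_rank_ltn lt_jj' jn; lia.
Qed.

(** The North step from rank a_j ends at rank a_j + kn + 1, one above the threshold of the bottom
    entry, so its end comes right after that entry. *)
Lemma bold_vertex (j : nat) : j < n -> exists i,
  [/\ i < M, nth false P i, north_rank j = r i & nranks (r i.+1) = (entry j k).+1].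
Proof.
move=> jn; have [i [iM north_i r_j]] := north_rankP jn; exists i; split=> //.
rewrite /entry r_j (r_north iM north_i) -(nranks_rankS iM) //.
exact: r_north.
Qed.

(** The upper bound holds because a bottom entry plus one is the position of a vertex, hence at most
    [M]. *)
Lemma entry_range (j l : nat) : j < n -> l <= k -> 0 < entry j l <= k.+1 * n.
Proof.
move=> jn lk; rewrite nranks_gt0 -ltnS.
have [i [iM _ _ bold_i]] := bold_vertex jn.
apply: leq_trans (nranks_max (r i.+1)); rewrite bold_i ltnS.
by apply: nranks_leq; rewrite leq_add2l leq_mul2r lk orbT.
Qed.

Lemma entry_onto (p : nat) : 0 < p <= k.+1 * n ->
  exists j l, [/\ j < n, l <= k & entry j l = p].
Proof.
move=> p_range; pose s := [seq entry j l | j <- iota 0 n, l <- iota 0 k.+1].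
have uniq_s : uniq s.
  apply: allpairs_uniq; rewrite ?iota_uniq // => z z' /allpairsP[[j l] [jn lk ->]].
  move=> /allpairsP[[j' l'] [jn' lk' ->]] /=; move: jn lk jn' lk'.
  by rewrite !mem_iota => jn lk jn' lk' /entry_inj[] // -> ->.
have sub_s : {subset s <= iota 1 (k.+1 * n)}.
  move=> _ /allpairsP[[j l] [+ + ->]]; rewrite !mem_iota /= => jn lk.
  by rewrite add1n ltnS entry_range.
have [|_ mem_s] := uniq_min_size uniq_s sub_s; first by rewrite size_allpairs !size_iota mulnC.
have : p \in s by rewrite mem_s mem_iota add1n ltnS.
by case/allpairsP => [[j l] []]; rewrite !mem_iota /= => jn lk ->; exists j, l.
Qed.

Lemma north_entry (i : nat) : i < M -> nth false P i ->
  exists2 j, j < n & nranks (r i) = entry j 0.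
Proof.
by move=> iM /(north_rank_onto iM)[j jn <-]; exists j; rewrite // /entry addn0.
Qed.

Lemma entry_letter (i j l : nat) : i < M -> j < n -> l <= k -> nranks (r i) = entry j l ->
  nth false P i = (l == 0).
Proof.
move=> iM jn lk eq_e; apply/idP/eqP => [north_i | l0].
  have [j' jn' eq_e'] := north_entry iM north_i.
  by have [] : j = j' /\ l = 0 by apply: entry_inj; rewrite // -eq_e.
have [i' [iM' north_i' r_j]] := north_rankP jn.
rewrite (_ : i = i') //; apply: nranks_rank_inj => //.
by rewrite eq_e l0 /entry addn0 r_j.
Qed.

Lemma first_row_letter (i : nat) : i < M ->
  (nranks (r i) \in mkseq (entry^~ 0) n) = nth false P i.
Proof.
move=> iM; apply/mapP/idP => [[j] | /(north_entry iM)[j jn ->]].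
  by rewrite mem_iota => jn /(entry_letter iM jn (leq0n k))->.
by exists j; rewrite ?mem_iota.
Qed.

Lemma filling_rank_cycle (D : path_word) : size D = M ->
  (forall i, i < M -> nth false D (nranks (r i)).-1 = nth false P i) ->
  filling k n D = mkseq (fun j => mkseq (entry j) k.+1) n.
Proof.
move=> size_D D_letter; apply: filling_entries => //.
- by rewrite size_D.
- exact: entry_range.
- exact: entry_onto.
- exact: entry_inj.
- by move=> j l jn lk; rewrite nranks_entry_ltn ?ltn_add2l ?ltn_pmul2r //;
    apply: entry_valueP => //; apply: ltnW.
- move=> j j' lt_jj' jn'; rewrite nranks_entry_ltn ?addn0 ?north_rank_ltn //.
    by rewrite -(addn0 (north_rank j)) -(mul0n n); apply: entry_valueP => //; apply: ltn_trans jn'.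
  by rewrite -(addn0 (north_rank j')) -(mul0n n); apply: entry_valueP.
(* Moving up one row subtracts n from both thresholds, which preserves their order. *)
- move=> j l j' l' jn lk jn' lk'.
  by rewrite !nranks_entry_leq; [lia | apply: entry_valueP; lia ..].
move=> j l jn lk; have /andP[e_gt0 e_le] := entry_range jn lk.
have [|i iM eq_e] := @nranks_onto (entry j l); first by rewrite e_gt0 leqW.
by rewrite -eq_e D_letter // (entry_letter iM jn lk).
Qed.

(** * The map f sends the position of a vertex to that of the next vertex *)

Let T : array := mkseq (fun j => mkseq (entry j) k.+1) n.
Let B : seq nat := bold k T.

Lemma first_row_entries : first_row T = mkseq (entry^~ 0) n.
Proof. by rewrite /first_row -map_comp; apply: eq_map. Qed.

Lemma bold_entries : B = mkseq (fun j => (entry j k).+1) n.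
Proof.
rewrite /B /bold -!map_comp; apply: eq_map => j; congr (_.+1).
exact: (nth_mkseq 0 (entry j) (ltnSn k)).
Qed.

Lemma nranks_next_inj (i j : nat) : i < M -> j < M ->
  nranks (r i.+1) = nranks (r j.+1) -> i = j.
Proof.
rewrite (leq_eqVlt i.+1) (leq_eqVlt j.+1).
move=> /predU1P[iM|iM] /predU1P[jM|jM]; first by move=> _; apply: succn_inj; rewrite iM jM.
- by rewrite iM r_M -r_0 => /nranks_rank_inj-/(_ isT jM).
- by rewrite jM r_M -r_0 => /nranks_rank_inj-/(_ iM isT).
by move=> /nranks_rank_inj-/(_ iM jM)[].
Qed.

Lemma nranks_next_onto (p : nat) : 0 < p <= M -> exists2 i, i < M & nranks (r i.+1) = p.
Proof.
case/nranks_onto => [[|i] iM <-]; last by exists i; rewrite // ltnW.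
by exists M.-1; rewrite ?prednK // r_M r_0.
Qed.

(** Bold entries are the positions of the ends of North steps, and different steps end at different
    positions. *)
Lemma bold_letter (i : nat) : i < M -> (nranks (r i.+1) \in B) = nth false P i.
Proof.
move=> iM; rewrite bold_entries; apply/mapP/idP => [[j] | north_i].
  rewrite mem_iota => /bold_vertex[i' [iM' north_i' _ <-]] /nranks_next_inj.
  by move=> /(_ iM iM')->.
have [j jn r_j] := north_rank_onto iM north_i; exists j; first by rewrite mem_iota.
have [i' [iM' _ r_j' <-]] := bold_vertex jn.
by rewrite (r_inj iM iM') // -r_j.
Qed.

(** The vertex of largest rank cannot be entered by an East step, which lowers the rank. *)
Lemma max_bold : M \in B.
Proof.
have [i iM pos_i] : exists2 i, i < M & nranks (r i.+1) = M.
  by apply: nranks_next_onto; rewrite leqnn.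
rewrite -pos_i bold_letter //; apply/negPn/negP => east_i.
have : nranks (r i) <= nranks (r i.+1) by rewrite pos_i nranks_max.
by rewrite nranks_rank_leq ?(ltnW iM) // (r_east iM east_i); lia.
Qed.

(* Subtracting [n] is increasing, so the East steps map their starting vertices
   monotonically onto the vertices that are not bold. *)
Lemma east_next (i c : nat) : i < M -> ~~ nth false P i -> n <= c ->
  nranks (r i) = nranks c ->
  (if nranks (c - n) \in B then max_nonbold_below B (nranks (c - n)) else nranks (c - n))
  = nranks (r i.+1).
Proof.
move=> iM east_i le_nc pos_i; set y := nranks (c - n).
have r_i := r_east iM east_i.
have le_ric : r i <= c by rewrite -nranks_rank_leq ?pos_i // ltnW.
have le_y : nranks (r i.+1) <= y by rewrite nranks_rank_leq //; lia.
have nbold_i : nranks (r i.+1) \notin B by rewrite bold_letter.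
(* A non-bold [z] is the position of the end of an East step. If that end has rank at most c - n,
   the step starts at rank at most c, so at a position no later than that of [i]; subtracting n
   again puts its end no higher than that of step [i]. *)
have next_max z : 0 < z <= y -> z \notin B -> z <= nranks (r i.+1).
  move=> /andP[z_gt0 le_zy].
  have [|i' iM' pos_z] := @nranks_next_onto z; first by rewrite z_gt0 (leq_trans le_zy) ?nranks_max.
  rewrite -pos_z bold_letter // => east_i'; have r_i' := r_east iM' east_i'.
  move: le_zy; rewrite -pos_z /y !nranks_rank_leq // => le_ri'.
  have : nranks (r i') <= nranks (r i) by rewrite pos_i nranks_rank_leq ?(ltnW iM') //; lia.
  by rewrite nranks_rank_leq ?(ltnW iM') //; lia.
case: ifPn => [bold_y | nbold_y]; last first.
  by apply/eqP; rewrite eqn_leq le_y next_max // nranks_gt0 leqnn.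
apply: max_nonbold_below_eq => // [|x /andP[x_gt0 /ltnW le_xy]].
  rewrite nranks_gt0 ltn_neqAle le_y andbT; apply: contra nbold_i => /eqP->.
  exact: bold_y.
by apply: next_max; rewrite x_gt0.
Qed.

Lemma find_column (j l : nat) : j < n -> l <= k -> find (fun c => entry j l \in c) T = j.
Proof.
move=> jn lk; apply: (find_eq (x0 := [::])) => [||j' lt_j'j]; rewrite ?size_mkseq //.
  by rewrite nth_mkseq //; apply/mapP; exists l; rewrite ?mem_iota.
have jn' := ltn_trans lt_j'j jn; rewrite nth_mkseq //; apply/mapP => [[l']].
rewrite mem_iota => lk' /entry_inj-/(_ jn lk jn' lk')[eq_j].
by rewrite eq_j ltnn in lt_j'j.
Qed.

Lemma index_entry (j l : nat) : j < n -> l <= k -> index (entry j l) (mkseq (entry j) k.+1) = l.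
Proof.
move=> jn lk; rewrite -(nth_mkseq 0 (entry j) (n := k.+1)) // index_uniq ?size_mkseq //.
rewrite map_inj_in_uniq ?iota_uniq // => l1 l2; rewrite !mem_iota => lk1 lk2.
by case/entry_inj.
Qed.

Lemma succ_next (i : nat) : i < M -> succ_fun k (k.+1 * n) T (nranks (r i)) = nranks (r i.+1).
Proof.
move=> iM; rewrite /succ_fun -/B -/M; case: eqP => [pos_i | /eqP ne_pos].
  have east_i : ~~ nth false P i.
    apply/negP => /(north_entry iM)[j jn]; have := entry_range jn (leq0n k); lia.
  (* The last position has no entry above it; the threshold r i + n also has position [M], and
     lowering it by n gives position [M] again, which is bold. *)
  rewrite -(@east_next i (r i + n)) ?leq_addl // ?addnK ?pos_i ?max_bold //.
  apply/eqP; rewrite eqn_leq nranks_max andbT -pos_i; apply: nranks_leq; exact: leq_addr.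
have [|j [l [jn lk entry_i]]] := @entry_onto (nranks (r i)).
  by rewrite nranks_gt0 -ltnS ltn_neqAle ne_pos nranks_max.
rewrite -entry_i find_column // nth_mkseq // index_entry //.
have letter_i := entry_letter iM jn lk (esym entry_i).
case: l lk entry_i letter_i => [|l] lk entry_i letter_i /=.
  have [i' [iM' _ r_j bold_i']] := bold_vertex jn.
  rewrite (@nranks_rank_inj i i') //; first by rewrite nth_mkseq ?bold_i'.
  by rewrite -entry_i /entry addn0 r_j.
(* The threshold of the entry itself is used as [c], so c - n is the threshold of the entry directly
   above. *)
have := @east_next i (north_rank j + l.+1 * n) iM; rewrite letter_i.
rewrite mulSnr addnA addnK nth_mkseq => [|//]; last by rewrite ltnW.
by apply=> //; rewrite ?leq_addl // -entry_i /entry mulSnr addnA.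
Qed.

Lemma nranks_0 : nranks (r 0) = 1.
Proof.
have [//|i iM pos_i] := @nranks_onto 1.
have : nranks (r 0) <= nranks (r i) by rewrite nranks_rank_leq // r_0.
by have := nranks_gt0 (r 0); lia.
Qed.

Lemma iter_succ (i : nat) : i <= M -> iter i (succ_fun k (k.+1 * n) T) 1 = nranks (r i).
Proof.
elim: i => [|i IHi] iM; first by rewrite nranks_0.
by rewrite iterS IHi ?(ltnW iM) // succ_next.
Qed.

Lemma traject_succ :
  traject (succ_fun k (k.+1 * n) T) 1 M = [seq nranks (r i) | i <- iota 0 M].
Proof.
apply: (@eq_from_nth _ 1); rewrite size_traject ?size_map ?size_iota // => i iM.
by rewrite nth_traject // (nth_map 0) ?size_iota // nth_iota // iter_succ // ltnW.
Qed.

Lemma last_traject_succ :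
  succ_fun k (k.+1 * n) T (last 1 (traject (succ_fun k (k.+1 * n) T) 1 M)) = 1.
Proof.
rewrite (last_nth 1) size_traject [nth _ _ _]nth_traject // -iterS iter_succ //.
by rewrite -[RHS]nranks_0 r_0 r_M.
Qed.

Lemma traject_succ_letters : size P = M ->
  [seq x \in first_row T | x <- traject (succ_fun k (k.+1 * n) T) 1 M] = P.
Proof.
move=> size_P; rewrite traject_succ -map_comp; apply: (@eq_from_nth _ false).
  by rewrite size_map size_iota.
move=> i; rewrite size_map size_iota => iM; rewrite (nth_map 0) ?size_iota //.
by rewrite nth_iota //= first_row_entries first_row_letter.
Qed.

End RankCycle.

(** * Natural-number ranks of a Dyck path, and the sweep of a Dyck path *)

Definition nat_rank (m n : nat) (P : path_word) (i : nat) : nat :=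
  ycoord P i * m - xcoord P i * n.

Lemma vertex_rank_ge0 (m n : nat) (P : path_word) (i : nat) :
  (0 <= vertex_rank m n P i)%R = (xcoord P i * n <= ycoord P i * m).
Proof. by rewrite /vertex_rank /rank Num.Theory.subr_ge0 lez_nat. Qed.

Lemma dyckP (m n : nat) (P : path_word) :
  reflect [/\ size P = m + n, count negb P = m, count id P = n
    & forall i, i <= m + n -> xcoord P i * n <= ycoord P i * m] (dyck m n P).
Proof.
apply: (iffP and4P) => [[/eqP size_P /eqP xP /eqP yP /allP pos] | [size_P xP yP pos]].
  move: xP yP; rewrite /xcoord /ycoord -size_P take_size => xP yP; split=> // i.
  rewrite size_P => le_i; have := pos i; rewrite mem_iota ltnS => /(_ le_i).
  by rewrite vertex_rank_ge0.
rewrite /xcoord /ycoord -size_P take_size size_P xP yP; split=> //.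
by apply/allP => i; rewrite mem_iota ltnS vertex_rank_ge0 => /pos.
Qed.

Lemma xcoordS (P : path_word) (i : nat) : i < size P ->
  xcoord P i.+1 = xcoord P i + ~~ nth false P i.
Proof. by move=> iP; rewrite /xcoord (take_nth false) // -cats1 count_cat /= addn0. Qed.

Lemma ycoordS (P : path_word) (i : nat) : i < size P ->
  ycoord P i.+1 = ycoord P i + nth false P i.
Proof. by move=> iP; rewrite /ycoord (take_nth false) // -cats1 count_cat /= addn0. Qed.

Lemma coord_sum (P : path_word) (i : nat) : i <= size P -> xcoord P i + ycoord P i = i.
Proof.
by move=> iP; rewrite addnC -[RHS](size_takel iP) -(count_predC id).
Qed.

Lemma size_sweep (m n : nat) (P : path_word) : size (sweep m n P) = size P.
Proof. by rewrite size_map size_sort size_iota. Qed.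

Section DyckRanks.

Variables (m n : nat) (P : path_word).
Hypothesis dyck_P : dyck m n P.
Let r := nat_rank m n P.

Lemma nat_rank_start : r 0 = 0. Proof. by rewrite /r /nat_rank /ycoord take0. Qed.

Lemma nat_rank_end : r (m + n) = 0.
Proof.
have /dyckP[size_P xP yP _] := dyck_P.
by rewrite /r /nat_rank /xcoord /ycoord -size_P take_size xP yP mulnC subnn.
Qed.

Lemma nat_rank_north (i : nat) : i < m + n -> nth false P i -> r i.+1 = r i + m.
Proof.
have /dyckP[size_P _ _ pos] := dyck_P; move=> iP north_i; have := pos i (ltnW iP).
by rewrite /r /nat_rank xcoordS ?ycoordS ?size_P // north_i addn0 addn1 mulSnr; lia.
Qed.

Lemma nat_rank_east (i : nat) : i < m + n -> ~~ nth false P i -> r i = r i.+1 + n.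
Proof.
have /dyckP[size_P _ _ pos] := dyck_P; move=> iP east_i; have := pos i.+1 iP.
rewrite /r /nat_rank xcoordS ?ycoordS ?size_P // (negbTE east_i) addn0 addn1 mulSnr; lia.
Qed.

(** On a Dyck path all ranks are nonnegative, so the truncated [nat_rank] orders the vertices as the
    integer rank does. *)
Lemma sweepE : exists s, [/\ perm_eq s (iota 0 (m + n)), sorted leq (map r s)
  & sweep m n P = map (nth false P) s].
Proof.
have /dyckP[size_P _ _ pos] := dyck_P.
pose le_rank i j := (vertex_rank m n P i <= vertex_rank m n P j)%R.
exists (sort le_rank (iota 0 (size P))); rewrite -size_P perm_sort perm_refl; split=> //.
have rank_total : total le_rank by move=> i j; apply: Order.TotalTheory.le_total.
rewrite sorted_map -(eq_in_sorted (P := leq^~ (m + n)) (e := le_rank)).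
- exact: sort_sorted.
- move=> i j /pos pos_i /pos pos_j; rewrite /le_rank /vertex_rank /rank /= /r /nat_rank.
  by rewrite !subzn // lez_nat.
by apply/allP => i; rewrite mem_sort mem_iota size_P => /ltnW.
Qed.

(* For a threshold t, the truncated sum of t - r over all vertices is invariant
   under moving each vertex to its successor; restricted to the j lowest
   vertices this bounds the East steps among them by the North steps. *)
Lemma dyck_sweep : dyck m n (sweep m n P).
Proof.
have /dyckP[size_P xP yP _] := dyck_P.
have [s [perm_s sorted_s sweep_eq]] := sweepE.
have perm_sweep : perm_eq (sweep m n P) P.
  rewrite sweep_eq; apply: perm_trans (perm_map _ perm_s) _.
  by rewrite -size_P -[X in perm_eq _ X](mkseq_nth false) perm_refl.
have size_s : size s = m + n by rewrite (perm_size perm_s) size_iota.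
apply/dyckP; split; rewrite ?size_sweep ?(permP perm_sweep) // => j.
rewrite leq_eqVlt => /predU1P[->|lt_j].
  rewrite /xcoord /ycoord -size_P -(size_sweep m n) take_size.
  by rewrite !(permP perm_sweep) xP yP mulnC.
rewrite /xcoord /ycoord sweep_eq -map_take !count_map.
(* The threshold is the rank of the first vertex left out of [A]: ranks in [A] are at most [t], the
   others at least [t]. *)
pose t := r (nth 0 s j); set A := take j s.
have r_nth a b : a <= b -> b < m + n -> r (nth 0 s a) <= r (nth 0 s b).
  move=> le_ab lt_b; rewrite -!(nth_map 0 0 r) ?size_s ?(leq_ltn_trans le_ab) //.
  by apply: (sorted_leq_nth leq_trans leqnn); rewrite ?inE ?size_map ?size_s ?(leq_ltn_trans le_ab).
have A_low v : v \in A -> v < m + n /\ r v <= t.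
  move=> vA; have : v \in s by apply: mem_take vA.
  rewrite (perm_mem perm_s) mem_iota => lt_v; split=> //.
  case/(nthP 0): vA => a; rewrite size_takel ?size_s ?(ltnW lt_j) // => lt_a <-.
  by rewrite nth_take //; apply: r_nth => //; apply: ltnW.
have drop_high v : v \in drop j s -> t <= r v.
  case/(nthP 0) => a; rewrite size_drop size_s nth_drop => lt_a <-.
  by apply: r_nth; lia.
have sum_s F : \sum_(v <- s) F v = \sum_(v < m + n) F v.
  by rewrite (perm_big _ perm_s) -(big_mkord xpredT F) /index_iota subn0.
(* Over all vertices, starts and ends of steps give the same sum; vertices outside [A] contribute
   nothing as starts, by truncation. *)
have cyc : \sum_(v <- A) (t - r v.+1) <= \sum_(v <- A) (t - r v).
  apply: (@leq_trans (\sum_(v <- s) (t - r v.+1))).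
    by rewrite -[in leqRHS](cat_take_drop j s) big_cat leq_addr.
  rewrite sum_s (sum_cycle (fun v => t - v)); last by rewrite nat_rank_start nat_rank_end.
  rewrite -(sum_s (fun v => t - r v)) -[in leqLHS](cat_take_drop j s) big_cat /=.
  rewrite [X in _ + X]big1_seq ?addn0 // => v /= /drop_high; lia.
(* For an East step from [A] the change by n is exact, since its start has rank at most [t]; for a
   North step truncation only lowers the loss below m. *)
have step : \sum_(v <- A) (t - r v + n * ~~ nth false P v) <=
            \sum_(v <- A) (t - r v.+1 + m * nth false P v).
  rewrite [leqLHS]big_seq [leqRHS]big_seq; apply: leq_sum => v /A_low[lt_v le_v].
  case: (boolP (nth false P v)) => [north_v | east_v] /=.
    by rewrite (nat_rank_north lt_v north_v); lia.
  by move: le_v; rewrite (nat_rank_east lt_v east_v); lia.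
have count_sum (a : pred nat) c : \sum_(v <- A) c * a v = c * count a A.
  by rewrite -big_distrr -sum1_count [in RHS]big_mkcond.
move: step; rewrite !big_split /= !count_sum => step.
rewrite !(mulnC (count _ _)) -(leq_add2l (\sum_(v <- A) (t - r v))).
by apply: leq_trans step _; rewrite leq_add2r.
Qed.

End DyckRanks.

(** * Distinctness of ranks when m = kn + 1 *)

Lemma fuss_length (k n : nat) : k * n + 1 + n = (k.+1 * n).+1.
Proof. by rewrite mulSn; lia. Qed.

Section FussRanks.

Variables (k n : nat) (P : path_word).
Hypothesis n_gt0 : 0 < n.
Hypothesis dyck_P : dyck (k * n + 1) n P.
Let m := k * n + 1.
Let M := (k.+1 * n).+1.
Let r := nat_rank m n P.

Let lengthE : m + n = M := fuss_length k n.

Lemma nat_rank_eq (i : nat) : i <= M -> r i + xcoord P i * n = ycoord P i * m.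
Proof. by have /dyckP[_ _ _ pos] := dyck_P; rewrite -lengthE => /pos; apply: subnK. Qed.

(** Since m = kn + 1 is congruent to 1, the rank modulo n is the height. *)
Lemma nat_rank_mod (i : nat) : i <= M -> r i = ycoord P i %[mod n].
Proof.
move=> iM; rewrite -(modnMDl (xcoord P i)) addnC nat_rank_eq // /m mulnDr muln1 mulnA.
by rewrite modnMDl.
Qed.

Lemma ycoord_leq (i j : nat) : i <= j -> ycoord P i <= ycoord P j.
Proof.
by move=> le_ij; rewrite /ycoord -(subnKC le_ij) takeD count_cat leq_addr.
Qed.

Lemma ycoord_max (i : nat) : ycoord P i <= n.
Proof.
have /dyckP[_ _ yP _] := dyck_P; rewrite -[X in _ <= X]yP /ycoord.
by rewrite -[in X in _ <= X](cat_take_drop i P) count_cat leq_addr.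
Qed.

Lemma nat_rank_inj (i j : nat) : i < M -> j < M -> r i = r j -> i = j.
Proof.
wlog lt_ij : i j / i < j.
  move=> wlog_ij iM jM r_ij; case: (ltngtP i j) => // lt; first exact: wlog_ij.
  by apply/esym; apply: wlog_ij.
move=> iM jM r_ij; have /dyckP[size_P _ _ _] := dyck_P.
have size_M : size P = M by rewrite size_P lengthE.
have := coord_sum (P := P) (i := i); rewrite size_M => /(_ (ltnW iM)) sum_i.
have := coord_sum (P := P) (i := j); rewrite size_M => /(_ (ltnW jM)) sum_j.
have eq_i := nat_rank_eq (ltnW iM); have eq_j := nat_rank_eq (ltnW jM).
have le_y := ycoord_leq (ltnW lt_ij); have y_max := ycoord_max j.
have n_dvd : n %| ycoord P j - ycoord P i.
  by rewrite -eqn_mod_dvd // eq_sym -(nat_rank_mod (ltnW iM)) r_ij (nat_rank_mod (ltnW jM)).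
(* The height difference is a multiple of n between 0 and n. If 0, the vertices coincide; if n, the
   heights are 0 and n, both ranks vanish, and [j] is the final vertex, excluded by [j < M]. *)
have [lt_y | ge_y] := ltnP (ycoord P j - ycoord P i) n.
  have y_eq : ycoord P j = ycoord P i.
    by move: n_dvd; rewrite /dvdn modn_small // => /eqP; lia.
  have : xcoord P i * n = xcoord P j * n by move: eq_i eq_j; rewrite y_eq r_ij; lia.
  by move/eqP; rewrite eqn_pmul2r // => /eqP; lia.
have [y_i y_j] : ycoord P i = 0 /\ ycoord P j = n by lia.
move: eq_i eq_j; rewrite y_i y_j mul0n => eq_i eq_j.
have : xcoord P j * n = m * n by lia.
by move/eqP; rewrite eqn_pmul2r // => /eqP; move: jM; rewrite -lengthE; lia.
Qed.

(** North steps start at pairwise distinct heights below n, and these heights are the residues of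
    their ranks. *)
Lemma north_rank_mod_inj (i j : nat) : i < M -> j < M ->
  nth false P i -> nth false P j -> r i = r j %[mod n] -> i = j.
Proof.
move=> iM jM north_i north_j; rewrite (nat_rank_mod (ltnW iM)) (nat_rank_mod (ltnW jM)).
have /dyckP[size_P _ _ _] := dyck_P.
have size_M : size P = M by rewrite size_P lengthE.
have y_next v : v < M -> nth false P v -> ycoord P v.+1 = (ycoord P v).+1.
  by move=> vM north_v; rewrite ycoordS ?size_M // north_v addn1.
have yi := ycoord_max i.+1; have yj := ycoord_max j.+1.
rewrite y_next // in yi; rewrite y_next // in yj; rewrite !modn_small // => y_eq.
case: (ltngtP i j) => // /ycoord_leq; rewrite y_next //; lia.
Qed.

Lemma count_north_steps : count (nth false P) (iota 0 M) = n.
Proof.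
have /dyckP[size_P _ yP _] := dyck_P.
rewrite -[RHS]yP -[in RHS](mkseq_nth false P) size_P lengthE count_map.
exact: eq_count.
Qed.

(** In a strictly sorted list of ranks, the number of ranks at most a given member is its 0-based
    index plus one; hence the predecessor. *)
Lemma sweep_letter (i : nat) : i < M ->
  nth false (sweep m n P) (nranks k n r (r i)).-1 = nth false P i.
Proof.
move=> iM; have [s [perm_s sorted_s ->]] := sweepE dyck_P.
rewrite -/m lengthE in perm_s.
have size_s : size s = M by rewrite (perm_size perm_s) size_iota.
have uniq_rs : uniq (map r s).
  rewrite map_inj_in_uniq ?(perm_uniq perm_s) ?iota_uniq // => a b.
  by rewrite !(perm_mem perm_s) !mem_iota; apply: nat_rank_inj.
have i_s : i \in s by rewrite (perm_mem perm_s) mem_iota.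
have lt_i : index i s < size s by rewrite index_mem.
have -> : nranks k n r (r i) = (index i s).+1.
  have -> : nranks k n r (r i) = count (leq^~ (r i)) (map r s).
    rewrite count_map (permP perm_s) -sum1_count big_mkcond /nranks.
    by rewrite -(big_mkord xpredT (fun v => r v <= r i : nat)) /index_iota subn0.
  rewrite -(nth_index 0 i_s) -(nth_map 0 0 r) //.
  rewrite (nth_index 0 i_s); apply: Order.POrderTheory.count_le_nth; rewrite ?size_map //.
  by rewrite Order.POrderTheory.lt_sorted_uniq_le uniq_rs.
by rewrite (nth_map 0) //= nth_index.
Qed.

End FussRanks.

(** * Inverting the sweep map *)

Section SweepInverse.

Variables (k n : nat) (P : path_word).
Hypothesis n_gt0 : 0 < n.
Hypothesis dyck_P : dyck (k * n + 1) n P.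
Let m := k * n + 1.
Let M := (k.+1 * n).+1.
Let T := filling k n (sweep m n P).
Let f := succ_fun k (k.+1 * n) T.
Let sigma := traject f 1 M.

(** Applies the rank-cycle results to [nat_rank]. The third clause rebuilds [P] from its sweep
    alone, which is what gives injectivity. *)
Lemma sweep_inverse :
  [/\ M \in bold k T, perm_eq sigma (iota 1 M) /\ f (last 1 sigma) = 1,
      [seq x \in first_row T | x <- sigma] = P
    & forall i, i < M -> nth false P i = nth false (sweep m n P) (nth 0 sigma i).-1].
Proof.
have /dyckP[size_P _ _ _] := dyck_P; have lengthE := fuss_length k n.
have size_M : size P = M by rewrite size_P lengthE.
pose r := nat_rank m n P.
have r_0 : r 0 = 0 by apply: nat_rank_start.
have r_M : r M = 0 by rewrite /M -lengthE; apply: nat_rank_end.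
have r_north i : i < M -> nth false P i -> r i.+1 = (r i + k * n).+1.
  by rewrite /M -lengthE => iM /(nat_rank_north dyck_P iM); rewrite -/m -/r /m; lia.
have r_east i : i < M -> ~~ nth false P i -> r i = r i.+1 + n.
  by rewrite /M -lengthE; apply: nat_rank_east.
have r_inj := nat_rank_inj n_gt0 dyck_P.
have r_mod := north_rank_mod_inj n_gt0 dyck_P.
have r_count := count_north_steps dyck_P.
have letter := sweep_letter n_gt0 dyck_P.
have T_eq : T = mkseq (fun j => mkseq (entry k n P r j) k.+1) n.
  by apply: filling_rank_cycle; rewrite ?size_sweep.
rewrite /sigma /f T_eq; split.
- exact: max_bold.
- split; last exact: last_traject_succ.
  by rewrite traject_succ // nranks_perm.
- exact: traject_succ_letters.
move=> i iM; rewrite traject_succ // (nth_map 0) ?size_iota // nth_iota // add0n.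
by rewrite letter.
Qed.

End SweepInverse.

Lemma sweep_inj (k n : nat) (P Q : path_word) : 0 < n ->
  dyck (k * n + 1) n P -> dyck (k * n + 1) n Q ->
  sweep (k * n + 1) n P = sweep (k * n + 1) n Q -> P = Q.
Proof.
move=> n_gt0 dP dQ eq_PQ.
have [_ _ omega_P _] := sweep_inverse n_gt0 dP; have [_ _ omega_Q _] := sweep_inverse n_gt0 dQ.
by rewrite -omega_P eq_PQ omega_Q.
Qed.

Lemma sweep_onto (k n : nat) (D : path_word) : 0 < n -> dyck (k * n + 1) n D ->
  exists2 P, dyck (k * n + 1) n P & sweep (k * n + 1) n P = D.
Proof.
set m := k * n + 1 => n_gt0 dyck_D.
pose S := [set P : (m + n).-tuple bool | dyck m n P].
(* The default value [P] of [insubd] is never taken, as the sweep preserves length. *)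
pose h (P : (m + n).-tuple bool) : (m + n).-tuple bool := insubd P (sweep m n P).
have hE P : val (h P) = sweep m n P by rewrite val_insubd size_sweep size_tuple eqxx.
have /eqP hS : h @: S == S.
  rewrite eqEcard card_in_imset ?leqnn ?andbT.
    apply/subsetP => _ /imsetP[P + ->]; rewrite !inE => dyck_P.
    by have := dyck_sweep dyck_P; rewrite -hE.
  move=> P Q; rewrite !inE => dP dQ eq_h; apply: val_inj.
  by apply: (sweep_inj n_gt0 dP dQ); rewrite -!hE eq_h.
have size_D : size D == m + n by have /dyckP[-> _ _ _] := dyck_D.
have : Tuple size_D \in h @: S by rewrite hS inE.
case/imsetP => P; rewrite inE => dyck_P D_eq; exists P => //.
by rewrite -hE -D_eq.
Qed.

Theorem theorem1p4 (k n : nat) (hk : 1 <= k) (hn : 1 <= n)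
    (D : path_word) (hD : dyck (k * n + 1) n D) :
  let m := k * n + 1 in
  let N := m + n - 1 in
  let T := filling k n D in
  let f := succ_fun k N T in
  let sigma := traject f 1 (m + n) in
  let omega := [seq x \in first_row T | x <- sigma] in
  [/\ N.+1 \in bold k T,
      perm_eq sigma (iota 1 (m + n)) /\ f (last 1 sigma) = 1,
      dyck m n omega /\ sweep m n omega = D,
      (forall P : path_word, dyck m n P -> sweep m n P = D -> P = omega)
    & (forall i : nat, i < m + n ->
         nth false omega i = nth false D (nth 0 sigma i).-1)].
Proof.
(* With [D] written as the sweep of [P], the word [omega] becomes [P] itself. *)
have [P dyck_P D_eq] := sweep_onto hn hD.
cbv zeta; rewrite fuss_length subn1 succnK -D_eq.
have [max_B [perm_sigma f_last] omega_eq letter] := sweep_inverse hn dyck_P.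
split=> // [|Q dyck_Q eq_QP|i iM]; rewrite omega_eq //; last exact: letter.
exact: sweep_inj eq_QP.
Qed.
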